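(* The class of interval graphs has unbounded symmetric difference; that is, for every integer $k$ there exists an interval graph $G$ with $\mathrm{sd}(G)>k$.
   Context: All graphs are finite, undirected, without loops and multiple edges. An interval graph is the intersection graph of (finitely many) intervals on the real line: each vertex can be associated with an interval so that two distinct vertices are adjacent if and only if the corresponding intervals intersect. For a graph $G$ and distinct vertices $x,y$ of $G$, let $\mathrm{sd}_G(x,y)$ be the number of vertices of $G$ different from $x$ and $y$ that are adjacent to exactly one of $x$ and $y$. The symmetric difference of $G$, denoted $\mathrm{sd}(G)$, is $0$ if $G$ is a single-vertex graph, and otherwise $$\mathrm{sd}(G)=\max_H\min_{x,y\in V(H),\,x\ne y}\mathrm{sd}_H(x,y),$$ where the maximum is over all induced subgraphs $H$ of $G$ with at least two vertices. *)

(* Defs.v *)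
From mathcomp Require Import all_boot all_order all_algebra.
From mathcomp Require Import reals.

Set Implicit Arguments.
Unset Strict Implicit.
Unset Printing Implicit Defensive.

Record sgraph : Type := SGraph {
  vertex :> finType;
  adj : rel vertex;
  adj_sym : symmetric adj;
  adj_irr : irreflexive adj }.

Section Induced.
Variables (G : sgraph) (H : {set G}).

Definition induced_adj : rel {x : G | x \in H} :=
  fun x y => adj (val x) (val y).

Lemma induced_adj_sym : symmetric induced_adj.
Proof. by move=> x y; apply: adj_sym. Qed.

Lemma induced_adj_irr : irreflexive induced_adj.
Proof. by move=> x; apply: adj_irr. Qed.

Definition induced : sgraph := SGraph induced_adj_sym induced_adj_irr.

End Induced.

Definition sd_pair (G : sgraph) (x y : G) : nat :=
  #|[set z : G | [&& z != x, z != y & adj z x (+) adj z y]]|.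

(* The default value #|G| exceeds every sd_pair x y, so on a graph with at    *)
(* least two vertices this is the minimum over distinct pairs (min_sdP).      *)
Definition min_sd (G : sgraph) : nat :=
  \big[minn/#|G|]_(p : G * G | p.1 != p.2) sd_pair p.1 p.2.

Lemma min_sdP (G : sgraph) : 1 < #|G| ->
  (exists x y : G, x != y /\ min_sd G = sd_pair x y) /\
  (forall x y : G, x != y -> min_sd G <= sd_pair x y).
Proof.
have le_min (x y : G) : x != y -> min_sd G <= sd_pair x y.
  move=> xy; rewrite /min_sd -minEnat.
  exact: (@Order.TotalTheory.bigmin_le_cond _ _ _ _ (x, y)
            (fun p : G * G => p.1 != p.2) (fun p => sd_pair p.1 p.2)).
case/card_gt1P=> x [y [_ _ xy]]; split=> //.
have [//|mG] : (exists a b : G, a != b /\ min_sd G = sd_pair a b) \/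
               min_sd G = #|G|.
  rewrite /min_sd; elim/big_rec: _ => [|[a b] m /= ab IH]; first by right.
  rewrite /minn; case: ifP => _; first by left; exists a, b.
  exact: IH.
exists x, y; split=> //; apply/eqP; rewrite eqn_leq le_min //=.
by rewrite mG /sd_pair max_card.
Qed.

(* An empty \max is 0, which is the value required of a single-vertex graph.  *)
Definition sd (G : sgraph) : nat :=
  \max_(H : {set G} | 1 < #|H|) min_sd (induced H).

(* Intervals are nonempty but otherwise arbitrary: each end may be open,      *)
(* closed or infinite.                                                        *)
Definition interval_graph (R : realType) (G : sgraph) : Prop :=
  exists I : G -> interval R,
    (forall x : G, exists r : R, r \in I x) /\
    (forall x y : G, x != y ->
       (adj x y <-> exists r : R, r \in I x /\ r \in I y)).

(* Main.v *)
(* Let w = 2m^2 and N = w * w. Take N long intervals [-p, sigma p], 0 <= p < N, *)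
(* all containing 0, where sigma transposes the w x w grid, together with     *)
(* point intervals at -2m, -4m, ... and at m, 3m, 5m, .... Two long intervals *)
(* whose left ends are close have right ends that are far apart, so many of   *)
(* these points lie in exactly one of them. The point at distance c from 0    *)
(* meets exactly N - c long intervals, so the degrees of two points differ by *)
(* at least m. Every long interval meets all the others, while a point misses *)
(* at least m of them.                                                        *)

Require Import Defs.
From mathcomp Require Import all_boot all_order all_algebra.
From mathcomp Require Import reals.
From mathcomp Require Import zify.

Set Implicit Arguments.
Unset Strict Implicit.
Unset Printing Implicit Defensive.

Import Order.TTheory GRing.Theory Num.Theory.

(** It suffices that in one interval graph every two vertices are separated by at least [m.-1]
    others ([leq_sd]). For two long intervals, the obstacle is close left ends: nearly consecutive
    cells of the grid lie in one row or in adjacent rows, and transposition sends them to distant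
    cells ([grid_transpose_far]). The gap thus obtained on one side contains [m.-1] point intervals
    ([sd_grid_intervals_far]). Pairs involving a point follow by counting neighbours
    ([card_grid_meets]). *)

Lemma sd_pairC (G : sgraph) (x y : G) : sd_pair x y = sd_pair y x.
Proof. by apply: eq_card => z; rewrite !inE andbCA addbC. Qed.

(** The whole vertex set is a legitimate choice of induced subgraph in the maximum defining [sd]. *)
Lemma leq_sd (G : sgraph) (K : nat) : 1 < #|G| ->
  (forall x y : G, x != y -> K <= sd_pair x y) -> K <= sd G.
Proof.
move=> G1 leK.
have T1 : 1 < #|[set: G]| by rewrite cardsT.
apply: leq_trans (@leq_bigmax_cond _ _ (fun H => min_sd (induced H)) _ T1).
have I1 : 1 < #|induced [set: G]| by rewrite card_sig cardsT.
have [[x [y [xy ->]]] _] := min_sdP I1.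
apply: leq_trans (leK (val x) (val y) _) _; first by rewrite val_eqE.
rewrite /sd_pair -(card_imset _ val_inj).
apply/subset_leq_card/subsetP => z; rewrite inE => zP.
apply/imsetP; exists (exist _ z (in_setT z)) => //.
by rewrite inE.
Qed.

Lemma leq_card_ord (T : finType) (K : nat) (A : {set T}) (f : 'I_K -> T) :
  injective f -> (forall i, f i \in A) -> K <= #|A|.
Proof.
move=> f_inj fA; rewrite -[leqLHS]card_ord -(card_imset _ f_inj).
by apply/subset_leq_card/subsetP => _ /imsetP[i _ ->].
Qed.

Lemma leq_card_symdiff (T : finType) (a b : pred T) :
  #|a| - #|b| <= #|[pred x | a x (+) b x]|.
Proof.
rewrite leq_subLR -cardUI; apply: leq_trans (leq_addr _ _).
apply/subset_leq_card/subsetP => x; rewrite !inE /= !unfold_in /=.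
by case: (a x) (b x) => [] [].
Qed.

Lemma card_ord_geq (N c : nat) : #|[pred p : 'I_N | c <= p]| = N - c.
Proof.
rewrite -sum1_card -(big_geq_mkord _ _ xpredT (fun=> 1)).
by rewrite sum_nat_const_nat muln1.
Qed.

Section Grid.

Variable w : nat.

Definition grid_transpose (p : nat) : nat := p %% w * w + p %/ w.

Lemma ltn_grid_transpose (p : nat) : p < w * w -> grid_transpose p < w * w.
Proof. by move=> pw; rewrite /grid_transpose; nia. Qed.

Lemma grid_transposeK (p : nat) :
  p < w * w -> grid_transpose (grid_transpose p) = p.
Proof.
move=> pw; have w0 : 0 < w by nia.
have qw : p %/ w < w by rewrite ltn_divLR.
rewrite /grid_transpose modnMDl divnMDl // (modn_small qw) (divn_small qw).
by rewrite addn0 -divn_eq.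
Qed.

(** In one row, a larger column moves the transpose up by at least [w]. Otherwise [q] is in the next
    row; as [q - p <= w - 2], its column is at least 2 smaller, so the transpose drops by at least
    [2 * w - 1]. *)
Lemma grid_transpose_far (p q D : nat) : D < w -> p < q -> q < p + D ->
  (grid_transpose p + D <= grid_transpose q) ||
  (grid_transpose q + D <= grid_transpose p).
Proof.
move=> Dw pq qpD; have w0 : 0 < w by lia.
have := divn_eq p w; have := divn_eq q w.
have := ltn_pmod p w0; have := ltn_pmod q w0.
rewrite /grid_transpose.
move: (p %% w) (q %% w) (p %/ w) (q %/ w) => b d a c dw bw eq ep.
have [ca|ca] : c = a \/ c = a.+1 by nia.
  by rewrite ca; apply/orP; left; nia.
by rewrite ca; apply/orP; right; nia.
Qed.

Lemma card_transpose_geq (c : nat) :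
  #|[pred p : 'I_(w * w) | c <= grid_transpose p]| = w * w - c.
Proof.
pose f (p : 'I_(w * w)) := Ordinal (ltn_grid_transpose (ltn_ord p)).
have fK : involutive f by move=> p; apply/val_inj/grid_transposeK.
rewrite -card_ord_geq; have := card_preim (inv_inj fK) [pred p | c <= val p].
rewrite (@eq_card _ [predI codom f & _] [pred p | c <= val p]) => [<-|p].
  exact: eq_card.
by rewrite !inE /= -[p]fK codom_f.
Qed.

End Grid.

Section GridGraph.

Variable m : nat.

Let w := 2 * m * m.
(** Chosen so that the farthest point is at distance [m * n = w * w], beyond the ends of all long
    intervals. *)
Let n := 2 * m * w.

(* inl p is the interval [-p, grid_transpose p]; inr s is the point m (s + 1) *)
(* for even s and - m (s + 1) for odd s.                                      *)
Definition grid_vertex : finType := ('I_(w * w) + 'I_n)%type.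

Definition grid_end (p : 'I_(w * w)) (left : bool) : nat :=
  if left then val p else grid_transpose w p.

Definition grid_meets (s : 'I_n) : pred 'I_(w * w) :=
  [pred p | m * s.+1 <= grid_end p (odd s)].

Definition grid_adj : rel grid_vertex := fun u v =>
  match u, v with
  | inl p, inl q => p != q
  | inl p, inr s | inr s, inl p => grid_meets s p
  | inr _, inr _ => false
  end.

Lemma grid_adj_sym : symmetric grid_adj.
Proof. by case=> [p|s] [q|t] //=; rewrite eq_sym. Qed.

Lemma grid_adj_irr : irreflexive grid_adj.
Proof. by case=> [p|s] //=; rewrite eqxx. Qed.

Definition grid_graph : sgraph := SGraph grid_adj_sym grid_adj_irr.

Lemma grid_sizeE : w * w = m * n.
Proof. by rewrite /n mulnA [m * _]mulnCA mulnA. Qed.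

Lemma leq_grid_point (s : 'I_n) : m * s.+1 <= w * w.
Proof. by rewrite grid_sizeE leq_mul2l ltn_ord orbT. Qed.

Lemma card_grid_meets (s : 'I_n) : #|grid_meets s| = w * w - m * s.+1.
Proof.
rewrite /grid_meets /grid_end; case: (odd s); first exact: card_ord_geq.
exact: card_transpose_geq.
Qed.

Lemma sd_grid_points (s t : 'I_n) : s != t ->
  m <= sd_pair (inr s : grid_graph) (inr t).
Proof.
wlog st : s t / s < t => [wl|_].
  move=> nst; have /orP[/wl->//|ts] : (s < t) || (t < s) by rewrite -neq_ltn.
  by rewrite sd_pairC wl // eq_sym.
have := leq_card_symdiff (grid_meets s) (grid_meets t).
rewrite !card_grid_meets => le1.
apply: (@leq_trans (w * w - m * s.+1 - (w * w - m * t.+1))).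
  by have := leq_grid_point t; move: (w * w) => N; nia.
apply: leq_trans le1 _.
have inlI : injective (inl : _ -> grid_graph) by move=> p q [].
rewrite -(card_imset _ inlI); apply/subset_leq_card/subsetP => _ /imsetP[p pP ->].
by rewrite inE.
Qed.

Lemma sd_grid_interval_point (p : 'I_(w * w)) (s : 'I_n) :
  m.-1 <= sd_pair (inl p : grid_graph) (inr s).
Proof.
have le1 : m <= #|predC (grid_meets s)|.
  have := cardC (grid_meets s); rewrite card_grid_meets card_ord.
  by have := leq_grid_point s; move: (w * w) #|_| => N d; nia.
(* [sd_pair] does not count [p] itself, which may be among the intervals missed by the point; hence
   the loss of one. *)
have le2 : m.-1 <= #|[predD1 predC (grid_meets s) & p]|.
  move: le1; rewrite (cardD1 p); move: (p \in _) #|_| => b d.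
  by case: b; lia.
apply: leq_trans le2 _.
have inlI : injective (inl : _ -> grid_graph) by move=> q r [].
rewrite -(card_imset _ inlI); apply/subset_leq_card/subsetP => _ /imsetP[q qP ->].
move: qP; rewrite !inE /= => /andP[qp qs].
by rewrite (negbTE qs) addbF; apply/andP.
Qed.

Lemma sd_grid_intervals_far (left : bool) (p q : 'I_(w * w)) :
  grid_end p left + 2 * m * m.-1 <= grid_end q left ->
  m.-1 <= sd_pair (inl p : grid_graph) (inl q).
Proof.
move=> far.
have [m0|m0] := posnP m; first by rewrite [m]m0.
have endw (r : 'I_(w * w)) : grid_end r left < w * w.
  rewrite /grid_end; case: (left); first exact: ltn_ord.
  exact: ltn_grid_transpose.
have qw := endw q.
(* With this [a], [c 0] indexes the first point on the chosen side strictly beyond the end of [p]: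
   even multiples of [m] on the left, odd ones on the right, whence the shift by [m]. The parity of
   [c i] selects the side. *)
pose a := (grid_end p left + if left then 0 else m) %/ (2 * m).
pose c i := 2 * (a + i) + left.
have c_mid (i : 'I_m.-1) :
    grid_end p left < m * (c i).+1 <= grid_end q left.
  have m2 : 0 < 2 * m by lia.
  have := ltn_ceil (grid_end p left + if left then 0 else m) m2.
  have := leq_trunc_div (grid_end p left + if left then 0 else m) (2 * m).
  have im : 2 * m * i.+1 <= 2 * m * m.-1 by rewrite leq_mul2l ltn_ord orbT.
  rewrite -/a /c; move: far im; move: (grid_end p left) (grid_end q left) (a).
  move: m.-1 (nat_of_ord i) => d j e e' b; case: (left) => /=; lia.
have cn (i : 'I_m.-1) : c i < n.
  have /andP[_ /leq_ltn_trans/(_ qw)] := c_mid i.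
  by rewrite grid_sizeE ltn_pmul2l // => /ltnW.
pose f (i : 'I_m.-1) : grid_graph := inr (Ordinal (cn i)).
apply: (@leq_card_ord _ _ _ f) => [i j [cij]|i].
  by move/addIn: cij => /eqP; rewrite eqn_pmul2l // eqn_add2l => /eqP/val_inj.
have c_odd : odd (c i) = left by rewrite /c oddD oddM /=; case: (left).
have /andP[ci1 ci2] := c_mid i.
by rewrite inE /= /grid_meets /= c_odd ci2 leqNgt ci1.
Qed.

Lemma sd_grid_intervals (p q : 'I_(w * w)) : p != q ->
  m.-1 <= sd_pair (inl p : grid_graph) (inl q).
Proof.
wlog pq : p q / p < q => [wl|_].
  move=> npq; have /orP[/wl->//|qp] : (p < q) || (q < p) by rewrite -neq_ltn.
  by rewrite sd_pairC wl // eq_sym.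
have [m0|m0] := posnP m; first by rewrite [m]m0.
have [far|near] := leqP (p + 2 * m * m.-1) q.
  exact: (@sd_grid_intervals_far true).
(* The value of [w] is dictated by this inequality. *)
have Dw : 2 * m * m.-1 < w by rewrite /w; nia.
have /orP[far|far] := grid_transpose_far Dw pq near.
  exact: (@sd_grid_intervals_far false).
by rewrite sd_pairC; apply: (@sd_grid_intervals_far false).
Qed.

Lemma sd_grid_graph : m.-1 <= sd grid_graph.
Proof.
have [m1|m1] := leqP m 1; first by move: (m) m1 => [|[]].
apply: leq_sd.
  rewrite card_sum !card_ord /n /w; nia.
case=> [p|s] [q|t] xy.
- exact: sd_grid_intervals.
- exact: sd_grid_interval_point.
- by rewrite sd_pairC; apply: sd_grid_interval_point.
- by apply: leq_trans (leq_pred _) _; apply: sd_grid_points.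
Qed.

Definition grid_interval (R : realType) (v : grid_graph) : interval R :=
  match v with
  | inl p => `[- p%:R, (grid_transpose w p)%:R]%R
  | inr s => let c : R := ((-1) ^+ odd s * (m * s.+1)%:R)%R in `[c, c]%R
  end.

Lemma grid_interval_graph (R : realType) : 0 < m -> interval_graph R grid_graph.
Proof.
move=> m0; exists (@grid_interval R).
have in0 p : (0 : R)%R \in @grid_interval R (inl p).
  by rewrite in_itv /= oppr_le0 !ler0n.
have meetsE p s : grid_meets s p <->
    exists r : R, r \in @grid_interval R (inl p) /\ r \in @grid_interval R (inr s).
  rewrite /grid_meets /= /grid_end.
  set c := m * s.+1; set x : R := (_ * c%:R)%R.
  (* Only the end on the side of [x] matters, since the long interval contains 0. *)
  have -> : (c <= (if odd s then val p else grid_transpose w p)) =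
      (x \in @grid_interval R (inl p)).
    rewrite in_itv /= /x; case: (odd s).
      rewrite expr1 mulN1r lerN2 ler_nat.
      by rewrite (le_trans (y := 0%R)) ?oppr_le0 ?ler0n // andbT.
    rewrite expr0 mul1r ler_nat.
    by rewrite (le_trans (y := 0%R)) ?oppr_le0 ?ler0n.
  split=> [xp|[r [rp]]]; first by exists x; rewrite xp in_itv /= lexx.
  by rewrite in_itv /= => rx; have -> : x = r by apply/eqP; rewrite eq_le.
split=> [[p|s]|[p|s] [q|t] nst].
- by exists 0%R; apply: in0.
- by exists ((-1) ^+ odd s * (m * s.+1)%:R)%R; rewrite in_itv /= lexx.
- split=> _; first by exists 0%R; rewrite !in0.
  exact: nst.
- exact: meetsE.
- by rewrite [adj _ _]/(grid_meets s q) meetsE; split=> -[r []]; exists r.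
- split=> // -[r []]; rewrite !in_itv /= => /le_anti <- /le_anti.
  (* Distances to 0 already tell the points apart, whatever their sides. *)
  move/(congr1 Num.norm); rewrite !normrMsign !normr_nat => /eqP.
  rewrite eqr_nat eqn_pmul2l // eqSS => /eqP/val_inj ts.
  by rewrite ts eqxx in nst.
Qed.

End GridGraph.

Local Open Scope ring_scope.

Theorem corollary5p3 (R : realType) (k : int) :
  exists G : sgraph, interval_graph R G /\ k < (sd G)%:Z.
Proof.
exists (grid_graph `|k|.+2); split; first exact: grid_interval_graph.
by have := sd_grid_graph `|k|.+2; lia.
Qed.
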